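(* Let $X$ be a real Banach space and $\delta>0$, and suppose that $X$ has $\delta$-cac. Then there exists a continuous map $\varphi:\ell_\infty(X)\to X$ such that $\varphi(\bar x)\in ac(\bar x)$ for every $\bar x\in\ell_\infty(X)$, and $\varphi(\bar x)=\varphi(\bar y)$ whenever $d(\bar x,\bar y)=0$. In particular, $\varphi$ satisfies, for every $\bar x=(x_n)_n\in\ell_\infty(X)$: (i) $\varphi(\bar x)=\lim_n x_n$ if $\bar x$ converges; (ii) $\varphi(\bar x)=\varphi(F(\bar x))$, where $F$ is the forward operator $F((x_n)_n)=(x_{n+1})_n$; (iii) $\varphi(\bar x)=\varphi((x_{\pi(n)})_n)$ for every bijection $\pi:\mathbb{N}\to\mathbb{N}$.
   Context: $\ell_\infty(X)$ is the space of bounded sequences in $X$ with the supremum norm, and $B_X$ is the closed unit ball of $X$. For $\bar x=(x_n)_n\in\ell_\infty(X)$: the asymptotic radius is $ar(\bar x)=\inf_{y\in X}\limsup_n\|x_n-y\|$; the asymptotic center is the set $ac(\bar x)=\{y\in X:\limsup_n\|x_n-y\|=ar(\bar x)\}$; and for $\delta\ge0$, $ac_\delta(\bar x)=\{y\in X:\limsup_n\|x_n-y\|\le ar(\bar x)+\delta\}$. For $\delta>0$, $X$ has $\delta$-cac (''continuity with respect to asymptotic centers'' with constant $\delta$) if every bounded sequence $\bar x$ in $X$ satisfies $ac_\delta(\bar x)\subseteq B_X+ac(\bar x)$. The $n$-th tail of $\bar x$ is $C_n(\bar x)=\{x_m:m\ge n\}$, and $d$ is the pseudometric on $\ell_\infty(X)$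 given by $$d(\bar x,\bar y)=\inf\{\varepsilon>0:\ \text{for every } n\in\mathbb{N}\text{ there exists } m\in\mathbb{N}\text{ such that } C_m(\bar x)\subseteq C_n(\bar y)+\varepsilon B_X\text{ and } C_m(\bar y)\subseteq C_n(\bar x)+\varepsilon B_X\}.$$ *)

(* Defs.v *)
From HB Require Import structures.
From mathcomp Require Import all_boot all_order all_algebra.
From mathcomp Require Import all_classical all_reals all_analysis.

Set Implicit Arguments.
Unset Strict Implicit.
Unset Printing Implicit Defensive.

Import Order.TTheory GRing.Theory Num.Theory.
Import numFieldNormedType.Exports.

Local Open Scope classical_set_scope.
Local Open Scope ring_scope.

Section Linf.
Context {R : realType} (X : normedModType R).

Definition linf_pred : {pred nat -> X} := mem [set x | bounded_fun x].

Record linf := Linf { linf_seq :> nat -> X; linf_seqP : linf_seq \in linf_pred }.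

HB.instance Definition _ := [isSub for linf_seq].
HB.instance Definition _ := [Choice of linf by <:].

Lemma linf_predP (x : nat -> X) :
  reflect (exists M, forall n, `|x n| <= M) (x \in linf_pred).
Proof.
have PF : ProperFilter (globally [set: nat]).
  exact: (@globally_properfilter nat setT 0%N).
apply: (iffP idP); rewrite inE/= => xb.
  by have [M xM] := (ex_bound _).1 xb; exists M => n; exact: xM.
by apply/ex_bound; case: xb => M xM; exists M => n _ /=; exact: xM.
Qed.

Lemma linf_submod_closed : submod_closed linf_pred.
Proof.
split; first by apply/linf_predP; exists 0 => n; rewrite normr0.
move=> a x y /linf_predP[M xM] /linf_predP[N yN]; apply/linf_predP.
exists (`|a| * M + N) => n.
rewrite (le_trans (ler_normD _ _))// lerD// normrZ.
by rewrite ler_wpM2l.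
Qed.

HB.instance Definition _ :=
  GRing.isSubmodClosed.Build _ _ linf_pred linf_submod_closed.
HB.instance Definition _ := [SubChoice_isSubLmodule of linf by <:].

Definition linf_norm (x : linf) : R := sup (range (fun n => `|x n|)).

Lemma linf_norm_has_sup (x : linf) : has_sup (range (fun n => `|x n|)).
Proof.
split; first by exists `|x 0%N|, 0%N.
by have /linf_predP[M xM] := linf_seqP x; exists M => _ [n _ <-].
Qed.

Lemma le_linf_norm (x : linf) n : `|x n| <= linf_norm x.
Proof. by apply: sup_upper_bound; [exact: linf_norm_has_sup|exists n]. Qed.

Lemma linf_norm_le (x : linf) M : (forall n, `|x n| <= M) -> linf_norm x <= M.
Proof.
move=> xM; apply: ge_sup; first by have [] := linf_norm_has_sup x.
by move=> _ [n _ <-].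
Qed.

Lemma linf_normD (x y : linf) : linf_norm (x + y) <= linf_norm x + linf_norm y.
Proof.
apply: linf_norm_le => n.
by rewrite (le_trans (ler_normD _ _))// lerD// le_linf_norm.
Qed.

Lemma linf_normZ (a : R) (x : linf) : linf_norm (a *: x) = `|a| * linf_norm x.
Proof.
have leZ b (y : linf) : linf_norm (b *: y) <= `|b| * linf_norm y.
  by apply: linf_norm_le => n; rewrite normrZ ler_wpM2l// le_linf_norm.
apply/eqP; rewrite eq_le leZ/=; have [->|a0] := eqVneq a 0.
  rewrite normr0 mul0r; exact: le_trans (normr_ge0 _) (le_linf_norm _ 0%N).
rewrite mulrC -ler_pdivlMr ?normr_gt0// mulrC -normfV.
by apply: le_trans (leZ _ _); rewrite scalerA mulVf// scale1r.
Qed.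

Lemma linf_norm0_eq0 (x : linf) : linf_norm x = 0 -> x = 0.
Proof.
move=> x0; apply/val_inj/funext => n.
by apply/eqP; rewrite -normr_le0; have := le_linf_norm x n; rewrite x0.
Qed.

HB.instance Definition _ :=
  Lmodule_isNormed.Build R linf linf_normD linf_normZ linf_norm0_eq0.

End Linf.

Arguments linf_pred {R} X.

Section Reindexing.
Context {R : realType} {X : normedModType R}.

Lemma linf_reindex_subproof (x : linf X) (s : nat -> nat) :
  (x : nat -> X) \o s \in linf_pred X.
Proof.
by have /linf_predP[M xM] := linf_seqP x; apply/linf_predP; exists M => n /=.
Qed.

Definition linf_reindex (x : linf X) (s : nat -> nat) : linf X :=
  Linf (linf_reindex_subproof x s).

Definition forward (x : linf X) : linf X := linf_reindex x succn.

End Reindexing.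

Section AsymptoticCenters.
Context {R : realType} {X : normedModType R}.

Definition unit_ball : set X := [set u | `|u| <= 1].

Definition Minkowski_sum (A B : set X) : set X := [set a + b | a in A & b in B].

Definition limsup_dist (x : linf X) (y : X) : R :=
  limn_sup (fun n => `|x n - y|).

Definition ar (x : linf X) : R := inf (range (limsup_dist x)).

Definition ac (x : linf X) : set X := [set y | limsup_dist x y = ar x].

Definition ac_ (delta : R) (x : linf X) : set X :=
  [set y | limsup_dist x y <= ar x + delta].

(* [sdrop x n] is the tail C_n(x) = {x_m : m >= n}. *)
Definition tail_close (e : R) (x y : linf X) : Prop :=
  forall n, exists m,
    sdrop x m `<=` Minkowski_sum (sdrop y n) [set e *: u | u in unit_ball] /\
    sdrop y m `<=` Minkowski_sum (sdrop x n) [set e *: u | u in unit_ball].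

Definition tail_dist (x y : linf X) : R :=
  inf [set e | 0 < e /\ tail_close e x y].

End AsymptoticCenters.

Definition cac {R : realType} (X : normedModType R) (delta : R) : Prop :=
  forall x : linf X, ac_ delta x `<=` Minkowski_sum unit_ball (ac x).

(* Main.v *)
Require Import Defs.
From HB Require Import structures.
From mathcomp Require Import all_boot all_order all_algebra.
From mathcomp Require Import all_classical all_reals all_analysis.
From mathcomp Require Import finmap ring lra.
From mathcomp Require wochoice.

(* By homogeneity, delta-cac means that ac_s(x) is within s/delta of ac(x) for
   every s >= 0. Hence x |-> ac(x) is Lipschitz in the Hausdorff distance with
   respect to the pseudometric sup_y |r_x(y) - r_x'(y)|, where
   r_x(y) = limsup |x_n - y|, and Michael's selection theorem on that
   pseudometric space yields phi. A map continuous for this pseudometric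
   depends on x only through r_x, which gives all the invariance properties;
   tail_dist 0 forces r_x = r_y. *)

Set Implicit Arguments.
Unset Strict Implicit.
Unset Printing Implicit Defensive.

Import Order.TTheory GRing.Theory Num.Theory.
Import numFieldNormedType.Exports.
Local Open Scope classical_set_scope.
Local Open Scope ring_scope.

(** * Locally finite refinements of open covers *)

(** Zermelo's well-ordering theorem: [lt] is the strict part of a well-order of [I], recorded
    through comparability and the existence of least elements. *)
Lemma exists_well_founded_tournament (I : choiceType) : exists lt : rel I,
  (forall i j, i != j -> lt i j \/ lt j i) /\
  (forall A : set I, A !=set0 -> exists2 i, A i & forall j, lt j i -> ~ A j).
Proof.
have [W Wwo] := wochoice.well_ordering_principle I.
have Wch : wochoice.wo_chain W predT by move=> B _; exact: Wwo.
have Wtot := wochoice.wo_chainW Wch.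
have Wanti := wochoice.wo_chain_antisymmetric Wch.
exists (fun i j => W i j && (i != j)); split=> [i j ij|A [a Aa]].
  by have /orP[->|->] := Wtot i j isT isT; rewrite ij; [left|right; rewrite eq_sym].
have [|i [[Ai imin] _]] := Wwo (mem A); first by exists a; exact/mem_set.
exists i; first exact/set_mem.
move=> j /andP[Wji /eqP ji] Aj; apply: ji; apply: Wanti => //.
by rewrite Wji imin//; exact/mem_set.
Qed.

Section sup0.
Context {R : realType} {I : Type}.
Implicit Types (J : set I) (f : I -> R).

(** Adjoining 0 gives the value 0 on an empty family, such as the predecessors of the least index,
    and a nonnegative value on every family bounded above. *)
Definition sup0 J f : R := sup (0 |` f @` J).

Lemma le_sup0 J f c i : (forall j, J j -> f j <= c) -> J i -> f i <= sup0 J f.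
Proof.
move=> fc Ji; apply: ub_le_sup; last by right; exists i.
exists (Num.max 0 c) => _ [->|[j Jj <-]]; first by rewrite le_max lexx.
by rewrite le_max fc ?orbT.
Qed.

Lemma sup0_ge0 J f c : (forall j, J j -> f j <= c) -> 0 <= sup0 J f.
Proof.
move=> fc; apply: ub_le_sup; last by left.
exists (Num.max 0 c) => _ [->|[j Jj <-]]; first by rewrite le_max lexx.
by rewrite le_max fc ?orbT.
Qed.

Lemma sup0_le J f c : 0 <= c -> (forall j, J j -> f j <= c) -> sup0 J f <= c.
Proof.
move=> c0 fc; apply: ge_sup; first by exists 0; left.
by move=> _ [->//|[j Jj <-]]; exact: fc.
Qed.

Lemma sup0_gt J f c : 0 <= c -> c < sup0 J f -> exists2 j, J j & c < f j.
Proof.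
move=> c0; rewrite ltNge => /negP cs; apply: contrapT => nex.
apply: cs; apply: sup0_le => // j Jj; rewrite leNgt; apply/negP => cj.
by apply: nex; exists j.
Qed.

End sup0.

(** * Lipschitz functions on a pseudometric space *)

Section ball_lipschitz.
Context {R : realType} {T : pseudoMetricType R}.

(** Phrased with balls because a [pseudoMetricType] carries balls and no distance function. The
    symmetry of balls supplies the opposite inequality. *)
Definition ball_lipschitz (k : R) (f : T -> R) :=
  forall x y e, 0 < e -> ball x e y -> f x <= f y + k * e.

Lemma ball_lipschitz_continuous k f :
  0 < k -> ball_lipschitz k f -> continuous f.
Proof.
move=> k0 fk x; apply/cvgrPdist_lt => e e0.
have d0 : 0 < e / (k * 2) by rewrite divr_gt0// mulr_gt0.
apply/nbhs_ballP; exists (e / (k * 2)) => //= y xy.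
have := fk _ _ _ d0 (ball_sym xy); have := fk _ _ _ d0 xy.
have -> : k * (e / (k * 2)) = e / 2 by field; lra.
by move=> ? ?; rewrite ltr_norml; apply/andP; split; lra.
Qed.

Lemma ball_lipschitz_sup0 (I : Type) (J : set I) (f : I -> T -> R) k c :
  0 <= k -> (forall j x, J j -> f j x <= c) ->
  (forall j, J j -> ball_lipschitz k (f j)) ->
  ball_lipschitz k (fun x => sup0 J (f^~ x)).
Proof.
move=> k0 fc fk x y e e0 xy.
apply: sup0_le => [|j Jj].
  rewrite addr_ge0//; last by rewrite mulr_ge0// ltW.
  by apply: (@sup0_ge0 _ _ _ _ c) => j /fc.
apply: le_trans (fk _ Jj _ _ _ e0 xy) _; rewrite lerD2r.
by apply: (@le_sup0 _ _ _ _ c) => // i /fc.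
Qed.

Lemma ball_lipschitz_pos_sub (a b c d : R) (f g : T -> R) :
  0 <= a -> 0 <= b -> 0 <= d -> 0 <= c -> a + d * b <= c ->
  ball_lipschitz a f -> ball_lipschitz b g ->
  ball_lipschitz c (fun x => Num.max 0 (f x - d * g x)).
Proof.
move=> a0 b0 d0 c0 abc fa gb x y e e0 xy.
have fxy := fa _ _ _ e0 xy; have gyx := gb _ _ _ e0 (ball_sym xy).
have ce : (a + d * b) * e <= c * e by rewrite ler_wpM2r// ltW.
have dg : d * g y <= d * (g x + b * e) by rewrite ler_wpM2l.
have m0 : 0 <= Num.max 0 (f y - d * g y) by rewrite le_max lexx.
have m1 : f y - d * g y <= Num.max 0 (f y - d * g y) by rewrite le_max lexx orbT.
have ce0 : 0 <= c * e by rewrite mulr_ge0// ltW.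
by rewrite ge_max; apply/andP; split; lra.
Qed.

End ball_lipschitz.

Section locally_finite.
Context {R : realType} {T : pseudoMetricType R} {I : choiceType}.

(* [h i x] is (up to truncation at 1) the distance from [x] to the complement of [U i]. *)
Lemma ball_lipschitz_cover (U : I -> set T) :
  (forall i, open (U i)) ->
  exists h : I -> T -> R, [/\ forall i, ball_lipschitz 1 (h i),
    forall i x, h i x <= 1 & forall i x, 0 < h i x <-> U i x].
Proof.
move=> Uopen.
pose J i x := [set r : R | 0 < r <= 1 /\ ball x r `<=` U i].
have J1 i x r : J i x r -> idfun r <= 1 by case=> /andP[].
exists (fun i x => sup0 (J i x) idfun); split => [i x y e e0 xy|i x|i x].
- have s0 : 0 <= sup0 (J i y) idfun by apply: (@sup0_ge0 _ _ _ _ 1) => r /J1.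
  apply: sup0_le => [|r Jr]; first by rewrite mul1r addr_ge0// ltW.
  have [re|er] := leP r e; first by rewrite mul1r (le_trans re)// lerDr.
  (* By the triangle inequality [ball y (r - e)] lies in [ball x r], so [r - e] is an admissible
     radius at [y]. *)
  rewrite mul1r -lerBlDr; apply: (@le_sup0 _ _ (J i y) idfun 1 (r - e)).
    by move=> j /J1.
  case: Jr => /andP[r0 r1] rU; split; first by apply/andP; split; lra.
  move=> z yz; apply: rU; have -> : r = e + (r - e) by ring.
  exact: ball_triangle xy yz.
- by apply: sup0_le => // r /J1.
- split => [/(sup0_gt (lexx 0))[r [/andP[r0 _] rU] _]|Uix].
    exact/rU/ballxx.
  have /nbhs_ballP[e /= e0 eU] : nbhs x (U i) by exact: open_nbhs_nbhs.
  have m0 : 0 < Num.min e 1 by rewrite lt_min e0/=.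
  apply: (lt_le_trans m0); apply: (@le_sup0 _ _ (J i x) idfun 1).
    by move=> j /J1.
  split; first by rewrite m0 ge_min lexx orbT.
  by apply: subset_trans eU; apply: le_ball; rewrite ge_min lexx.
Qed.

(* Values [h i] exceeding all preceding ones by more than [a] are [a]-separated
   in [0, 1], hence finite in number. *)
Lemma finite_record_set (lt : rel I) (h : I -> R) a :
  (forall i j, i != j -> lt i j \/ lt j i) -> 0 < a -> (forall i, h i <= 1) ->
  finite_set [set i | a < Num.max 0 (h i - sup0 [set j | lt j i] h)].
Proof.
move=> lt_total a0 h1; set D := [set i | _].
have sup_ge0 i : 0 <= sup0 [set j | lt j i] h.
  by apply: (@sup0_ge0 _ _ _ _ 1) => j _.
have Dh i : D i -> a + sup0 [set j | lt j i] h < h i.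
  by rewrite /D/= lt_max => /orP[|]; lra.
have h0 i : D i -> 0 <= h i by move=> /Dh; have := sup_ge0 i; lra.
have sep i j : D i -> D j -> lt i j -> h i / a + 1 < h j / a.
  move=> Di /Dh Dj ij.
  have ha : h i + a < h j.
    apply: le_lt_trans Dj; rewrite addrC lerD2l.
    by apply: (@le_sup0 _ _ [set k | lt k j] h 1) => // k _.
  rewrite -ltrBrDl -mulrBl ltr_pdivlMr//; lra.
have trunc_lt i j : D i -> D j -> lt i j ->
    (Num.truncn (h i / a) < Num.truncn (h j / a))%N.
  move=> Di Dj /(sep _ _ Di Dj) ij.
  have hi0 : 0 <= h i / a by rewrite divr_ge0 ?h0// ltW.
  have hj0 : 0 <= h j / a by rewrite divr_ge0 ?h0// ltW.
  rewrite truncn_ge_nat// -natr1.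
  by have /andP[+ _] := truncn_itv hi0; lra.
(* Distinct records have distinct integer parts of [h i / a], and these are at most the integer part
   of [1 / a]. *)
have inj : {in D &, injective (fun i => Num.truncn (h i / a))}.
  move=> i j /set_mem Di /set_mem Dj eq_ij; apply/eqP/negP => /negP ij.
  by have [/(trunc_lt _ _ Di Dj)|/(trunc_lt _ _ Dj Di)] := lt_total _ _ ij;
    rewrite eq_ij ltnn.
have imfin : finite_set ((fun i => Num.truncn (h i / a)) @` D).
  apply: (sub_finite_set _ (finite_II (Num.truncn (1 / a)).+1)) => _ [i Di <-] /=.
  by rewrite ltnS le_truncn// ler_wpM2r// invr_ge0 ltW.
by apply: card_le_finite imfin; have /card_eqPle[] := inj_card_eq inj.
Qed.

(* A Mather-type refinement: well-order [I], let [g i] be the excess of [h i]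
   over the supremum of its predecessors, and truncate [g i] at half of the
   supremum of all [g j]. *)
Lemma locally_finite_refinement (U : I -> set T) :
  (forall i, open (U i)) -> (forall x, exists i, U i x) ->
  exists p : I -> T -> R,
    [/\ forall i, continuous (p i), forall i x, 0 <= p i x,
        forall i x, 0 < p i x -> U i x, forall x, exists i, 0 < p i x &
        forall x : T, exists A : {fset I},
          \forall y \near x, forall i, i \notin A -> p i y = 0].
Proof.
move=> Uopen Ucover.
have [lt [lt_total lt_wf]] := exists_well_founded_tournament I.
have [h [h_lip h1 hU]] := ball_lipschitz_cover Uopen.
pose H i x := sup0 [set j | lt j i] (h^~ x).
pose g i x := Num.max 0 (h i x - 1 * H i x).
pose G x := sup0 setT (g^~ x).
pose p i x := Num.max 0 (g i x - 2^-1 * G x).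
have H_lip i : ball_lipschitz 1 (H i).
  by apply: (@ball_lipschitz_sup0 _ _ _ _ _ _ 1) => // j _; exact: h_lip.
have H0 i x : 0 <= H i x by apply: (@sup0_ge0 _ _ _ _ 1) => j _; exact: h1.
have g_lip i : ball_lipschitz 2 (g i).
  by apply: (@ball_lipschitz_pos_sub _ _ 1 1 _ 1); rewrite ?mul1r//; apply: ler0n.
have g1 i x : g i x <= 1.
  by rewrite ge_max ler01/= mul1r; have := H0 i x; have := h1 i x; lra.
have G_lip : ball_lipschitz 2 G.
  by apply: (@ball_lipschitz_sup0 _ _ _ _ _ _ 1) => // j _; exact: g_lip.
have p_lip i : ball_lipschitz 3 (p i).
  by apply: (@ball_lipschitz_pos_sub _ _ 2 2 _ 2^-1) => //; lra.
have gG i x : g i x <= G x by apply: (@le_sup0 _ _ _ (g^~ x) 1).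
have G0 x : 0 < G x.
  have [j /hU hj] := Ucover x.
  (* At the least index [i] with [0 < h i x], all predecessors have nonpositive values, so nothing
     is subtracted from [h i x] and [g i x] is positive. *)
  have [i hi imin] : exists2 i, 0 < h i x & forall j, lt j i -> ~ 0 < h j x.
    by apply: (lt_wf [set i | 0 < h i x]); exists j.
  apply: lt_le_trans (gG i x); rewrite lt_max; apply/orP; right.
  suff : H i x <= 0 by lra.
  by apply: sup0_le => // k /imin /negP; rewrite -leNgt.
exists p; split => [i|i x|i x|x|x].
- exact: (ball_lipschitz_continuous _ (p_lip i)).
- by rewrite le_max lexx.
- rewrite lt_max ltxx/= subr_gt0 => gi; apply/hU.
  have : 0 < g i x by have := G0 x; lra.
  by rewrite lt_max ltxx/=; have := H0 i x; lra.
- have Gx := G0 x; have c0 : 0 <= 2^-1 * G x by lra.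
  have cG : 2^-1 * G x < sup0 setT (g^~ x) by rewrite -/(G x); lra.
  have [i _ gi] := sup0_gt c0 cG.
  by exists i; rewrite lt_max subr_gt0 gi orbT.
(* If [g i x <= G x / 4], the Lipschitz constant 2 gives on the ball of radius [e] that [g i y] is
   at most 6/16 of [G x], while half of [G y] is at least 7/16 of [G x]; hence [p i y = 0]. *)
- pose e := G x / 16; have e0 : 0 < e by rewrite divr_gt0.
  have fin : finite_set [set i | G x / 4 < g i x].
    rewrite /g; under eq_set do rewrite mul1r.
    by apply: (@finite_record_set _ (h^~ x)) => //; rewrite divr_gt0.
  exists (fset_set [set i | G x / 4 < g i x]).
  apply/nbhs_ballP; exists e => //= y xy i; rewrite in_fset_set// => iD.
  apply/eqP; rewrite eq_le le_max lexx andbT ge_max lexx/= subr_le0.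
  have : g i x <= G x / 4 by rewrite leNgt; apply/negP => /mem_set; exact/negP.
  have := g_lip i _ _ _ e0 (ball_sym xy); have := G_lip _ _ _ e0 xy.
  by have := G0 x; rewrite /e; lra.
Qed.

End locally_finite.

(** * Browder's and Michael's selection theorems *)

Section convex.
Context {R : realType} {V : lmodType R}.

Lemma convex_setP (A : set V) : convex_set (A : set (convex_lmodType V)) <->
  forall x y t, A x -> A y -> 0 <= t -> t <= 1 -> A (t *: x + (1 - t) *: y).
Proof.
split=> [cA x y t Ax Ay t0 t1|cA x y l /set_mem Ax /set_mem Ay].
  by have /set_mem := cA x y (Itv01 t0 t1) (mem_set Ax) (mem_set Ay).
by apply/mem_set; apply: cA.
Qed.

(** Induction on [s]: the mean over [i :: s] is a convex combination of [v i] and the mean over [s].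
    Membership is asked only where the weight is positive, which is all that the functions of a
    refinement guarantee. *)
Lemma convex_weighted_mean (I : choiceType) (A : set V) (s : seq I) (w : I -> R)
    (v : I -> V) :
  convex_set (A : set (convex_lmodType V)) ->
  (forall i, 0 <= w i) -> (forall i, 0 < w i -> A (v i)) ->
  0 < \sum_(i <- s) w i ->
  A ((\sum_(i <- s) w i)^-1 *: \sum_(i <- s) w i *: v i).
Proof.
move=> /convex_setP cA w0 wA; elim: s => [|i s IH]; first by rewrite big_nil ltxx.
rewrite !big_cons; have := w0 i; rewrite le_eqVlt => /orP[/eqP<-|wi].
  by rewrite add0r scale0r add0r.
have s0 : 0 <= \sum_(j <- s) w j by rewrite sumr_ge0.
(* If the remaining weights sum to 0, they all vanish and the mean is [v i]; the induction
   hypothesis needs a positive sum. *)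
have := s0; rewrite le_eqVlt => /orP[/eqP ws _|ws _].
  have -> : \sum_(j <- s) w j *: v j = 0.
    apply: big1_seq => j /andP[_ js].
    move: (esym ws) => /eqP; rewrite psumr_eq0// => /allP/(_ _ js)/eqP ->.
    by rewrite scale0r.
  by rewrite -ws !addr0 scalerA mulVf ?gt_eqF// scale1r; exact: wA.
have S0 : 0 < w i + \sum_(j <- s) w j by rewrite addr_gt0.
have := cA _ _ (w i / (w i + \sum_(j <- s) w j)) (wA _ wi) (IH ws).
set S := \sum_(j <- s) w j; set Z := \sum_(j <- s) w j *: v j.
have -> : (w i / (w i + S)) *: v i + (1 - w i / (w i + S)) *: (S^-1 *: Z) =
    (w i + S)^-1 *: (w i *: v i + Z).
  rewrite scalerDr !scalerA; congr (_ *: _ + _ *: _); first by rewrite mulrC.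
  by field; rewrite /S !gt_eqF.
by apply; rewrite ?ler_pdivrMr ?mul1r ?lerDl// divr_ge0// ltW.
Qed.

End convex.

Section Browder.
Context {R : realType} {T : pseudoMetricType R} {V : normedModType R}.

(** Browder's argument: the fibers form an open cover of [T] indexed by the points [v] of [V].
    Averaging these points with weights [p v x] involves only [v] in [Phi x], so convexity keeps the
    average in [Phi x]. *)
Lemma continuous_selection_open_fibers (Phi : T -> set V) :
  (forall x, Phi x !=set0) ->
  (forall x, convex_set (Phi x : set (convex_lmodType V))) ->
  (forall v, open [set x | Phi x v]) ->
  exists2 f : T -> V, continuous f & forall x, Phi x (f x).
Proof.
move=> Phi0 Phi_convex Phi_open.
have [p [p_cont p0 pPhi p_pos p_fin]] := locally_finite_refinement Phi_open Phi0.
(* The [p v] are not normalised, hence the division. Finitely supported sums define [f] globally;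
   near each point they reduce to sums over one fixed finite set, where continuity is clear. *)
pose f x := (\sum_(v \in setT) p v x)^-1 *: \sum_(v \in setT) p v x *: v.
have fE (A : {fset V}) x : (forall v, v \notin A -> p v x = 0) ->
    f x = (\sum_(v <- A) p v x)^-1 *: \sum_(v <- A) p v x *: v.
  move=> pA; rewrite /f (@fsbigTE _ _ _ _ A) ?(@fsbigTE _ _ _ _ A)//.
  by move=> v /pA ->; rewrite scale0r.
have sum_gt0 (A : {fset V}) x : (forall v, v \notin A -> p v x = 0) ->
    0 < \sum_(v <- A) p v x.
  move=> pA; have [v pv] := p_pos x.
  have vA : v \in A by apply/negP => /negP /pA pv0; rewrite pv0 ltxx in pv.
  by rewrite (big_fsetD1 v)//= ltr_wpDr// sumr_ge0.
exists f => x.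
  have [A xA] := p_fin x.
  have fA : \forall y \near x, (\sum_(v <- A) p v y)^-1 *: (\sum_(v <- A) p v y *: v) = f y.
    by near=> y; rewrite (fE A)//; near: y.
  have pAx := nbhs_singleton xA.
  rewrite /prop_for/continuous_at (fE A)//; apply: cvg_trans (near_eq_cvg fA) _.
  apply: cvgZ.
    apply: cvgV; first by rewrite gt_eqF// sum_gt0.
    by apply: (cvg_big add_continuous) => v _; exact: p_cont.
  by apply: (cvg_big add_continuous) => v _; apply: cvgZl; exact: p_cont.
have [A xA] := p_fin x; have pAx := nbhs_singleton xA.
rewrite (fE A)//; apply: convex_weighted_mean => // [v|]; first exact: pPhi.
exact: sum_gt0.
Unshelve. all: by end_near. Qed.

End Browder.

Definition lower_hemicontinuous (T V : topologicalType) (F : T -> set V) :=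
  forall O, open O -> open [set x | F x `&` O !=set0].

Lemma convex_combination_lt (R : realFieldType) (a b c t : R) :
  0 <= t -> t <= 1 -> a < c -> b < c -> t * a + (1 - t) * b < c.
Proof.
move=> t0 t1 ac bc; have m_lt : Num.max a b < c by rewrite gt_max ac.
apply: le_lt_trans m_lt; set m := Num.max a b.
have : t * a <= t * m by rewrite ler_wpM2l// le_max lexx.
have : (1 - t) * b <= (1 - t) * m by rewrite ler_wpM2l ?subr_ge0// le_max lexx orbT.
lra.
Qed.

Lemma exists_expV2_lt (R : archiRealFieldType) (e : R) :
  0 < e -> exists n, 2 ^- n < e.
Proof.
move=> e0; exists (Num.truncn e^-1); rewrite invf_plt ?posrE ?exprn_gt0//.
have /truncn_itv/andP[_ /lt_le_trans] : 0 <= e^-1 by rewrite invr_ge0 ltW.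
by apply; rewrite -natrX ler_nat ltn_expl.
Qed.

Section Michael.
Context {R : realType} {T : pseudoMetricType R}.

Lemma lower_hemicontinuous_ball (V : normedModType R) (F : T -> set V)
    (f : T -> V) e :
  lower_hemicontinuous F -> continuous f ->
  lower_hemicontinuous (fun x => F x `&` ball (f x) e).
Proof.
move=> F_lsc f_cont O O_open; rewrite openE => x [v [[Fv fv] Ov]].
(* [d] is half of the slack of [v] in the ball: one half absorbs the variation of [f], the other the
   passage from [v] to a nearby point of [F y]. *)
move: fv; rewrite -ball_normE /= => fv; pose d := (e - `|f x - v|) / 2.
have d0 : 0 < d by rewrite divr_gt0// subr_gt0.
have near_F : \forall y \near x, F y `&` (O `&` ball v d) !=set0.
  apply: open_nbhs_nbhs; split; last by exists v; do !split => //; exact: ballxx.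
  by apply/F_lsc/openI => //; exact: ball_open.
have near_f : \forall y \near x, `|f x - f y| < d.
  by move/cvgrPdist_lt: (f_cont x); exact.
rewrite /interior/=; near=> y.
have [w [Fw [Ow]]] : F y `&` (O `&` ball v d) !=set0 by near: y.
have fxy : `|f x - f y| < d by near: y.
rewrite -ball_normE /= => vw; exists w; do !split => //=.
rewrite (_ : f y - w = (f y - f x) + (f x - v) + (v - w)); last first.
  by rewrite !addrA !subrK.
rewrite (le_lt_trans (ler_normD _ _))//.
have := ler_normD (f y - f x) (f x - v); rewrite (distrC (f y)).
by move: fxy vw; rewrite /d; lra.
Unshelve. all: by end_near. Qed.

(** The open [e]-neighbourhood of [F x] is convex, and its fiber over [v] is the set of [x] for
    which [F x] meets [ball v e], open by lower hemicontinuity. So Browder's theorem applies to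
    it. *)
Lemma approximate_selection (V : normedModType R) (F : T -> set V) e :
  0 < e -> (forall x, F x !=set0) ->
  (forall x, convex_set (F x : set (convex_lmodType V))) ->
  lower_hemicontinuous F ->
  exists2 f : T -> V, continuous f & forall x, F x `&` ball (f x) e !=set0.
Proof.
move=> e0 F0 F_convex F_lsc.
apply: (@continuous_selection_open_fibers _ _ _
  (fun x => [set y | F x `&` ball y e !=set0])) => [x|x|v].
- by have [v Fv] := F0 x; exists v, v; split => //; exact: ballxx.
- apply/convex_setP => y z t [v [Fv yv]] [w [Fw zw]] t0 t1.
  exists (t *: v + (1 - t) *: w); split; first by move/convex_setP: (F_convex x); exact.
  move: yv zw; rewrite -ball_normE /= => yv zw.
  have -> : t *: y + (1 - t) *: z - (t *: v + (1 - t) *: w) =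
      t *: (y - v) + (1 - t) *: (z - w) by rewrite !scalerBr opprD addrACA.
  rewrite (le_lt_trans (ler_normD _ _))// !normrZ (ger0_norm t0) ger0_norm ?subr_ge0//.
  exact: convex_combination_lt.
- by apply: F_lsc; exact: ball_open.
Qed.

(** Summing the steps from [n] on gives the error bound. Since it depends only on [c] and [n],
    pointwise use on a sequence of functions yields uniform convergence. *)
Lemma geometric_cvg (V : completeNormedModType R) (u : nat -> V) c :
  (forall n, `|u n - u n.+1| <= c / 2 ^+ n) ->
  exists l, forall n, `|l - u n| <= 2 * c / 2 ^+ n.
Proof.
move=> uc.
have c0 : 0 <= c by have := le_trans (normr_ge0 _) (uc 0%N); rewrite expr0 divr1.
have pow0 k : 0 < 2 ^+ k :> R by rewrite exprn_gt0.
(* The subtracted term is what lets the induction on [k] close. *)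
have dist n k : `|u n - u (n + k)%N| <= 2 * c / 2 ^+ n - 2 * c / 2 ^+ (n + k).
  elim: k => [|k IH]; first by rewrite addn0 !subrr normr0.
  rewrite addnS -[u n](subrK (u (n + k)%N)) -addrA (le_trans (ler_normD _ _))//.
  apply: le_trans (lerD IH (uc _)) _; rewrite exprS invfM.
  by have := pow0 (n + k)%N; set a := _ ^- (n + k); lra.
have distW n k : `|u n - u (n + k)%N| <= 2 * c / 2 ^+ n.
  by apply: le_trans (dist n k) _; rewrite gerBl divr_ge0// ?mulr_ge0// ltW.
have small e : 0 < e -> exists n, 2 * c / 2 ^+ n < e.
  (* Adding 1 keeps the divisor positive when [c = 0]. *)
  move=> e0; have c1 : 0 < 2 * c + 1 by lra.
  have [|n ne] := @exists_expV2_lt R (e / (2 * c + 1)); first by rewrite divr_gt0.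
  exists n; move: ne; rewrite ltr_pdivlMr//.
  by have := pow0 n; rewrite -invr_gt0; set a := _ ^-1; lra.
have /cauchy_cvgP/cvg_ex[l ul] : cauchy (u @ \oo).
  apply: cauchy_exP => e e0; have [n ne] := small _ e0.
  exists (u n); exists n => //= m /= nm; rewrite -ball_normE /=.
  by rewrite -(subnKC nm); apply: le_lt_trans ne.
exists l => n; apply/ler_addgt0Pr => e e0.
move/cvgrPdist_lt: ul => /(_ _ e0)[m _ /(_ (n + m)%N (leq_addl _ _))] lm.
have := ler_normD (l - u (n + m)%N) (u (n + m)%N - u n).
rewrite addrA subrK (distrC (u (n + m)%N)).
by move: lm (distW n m) => /=; lra.
Qed.

(** Successive approximation: given [f] within [2 ^- n] of [F], an approximate selection of [F x]
    cut down to [ball (f x) (2 ^- n)] is within [2 ^- n.+1] of [F] and uniformly close to [f]. The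
    uniform limit is continuous, and closedness puts its values in [F x]. *)
Theorem Michael_selection (V : completeNormedModType R) (F : T -> set V) :
  (forall x, F x !=set0) ->
  (forall x, convex_set (F x : set (convex_lmodType V))) ->
  (forall x, closed (F x)) -> lower_hemicontinuous F ->
  exists2 f : T -> V, continuous f & forall x, F x (f x).
Proof.
move=> F0 F_convex F_closed F_lsc.
pose approx n f := continuous f /\ forall x, F x `&` ball (f x : V) (2 ^- n) !=set0.
have pow0 n : 0 < 2 ^- n :> R by rewrite invr_gt0 exprn_gt0.
(* The hypothesis stands under the existential so that [choice] yields a total function; on pairs
   that violate it, [f] itself is a dummy value. *)
have step (nf : nat * (T -> V)) : exists g, approx nf.1 nf.2 ->
    approx nf.1.+1 g /\ forall x, `|nf.2 x - g x| <= 2 / 2 ^+ nf.1.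
  case: nf => n f /=; have [[f_cont Ff]|] := pselect (approx n f); last first.
    by exists f.
  have [|||g g_cont Fg] := @approximate_selection _
      (fun x => F x `&` ball (f x) (2 ^- n)) (2 ^- n.+1) (pow0 _).
  - exact: Ff.
  - move=> x; apply/convex_setP => y z t [Fy fy] [Fz fz] t0 t1.
    split; first by move/convex_setP: (F_convex x); exact.
    move: fy fz; rewrite -ball_normE /= => fy fz.
    have -> : f x - (t *: y + (1 - t) *: z) =
        t *: (f x - y) + (1 - t) *: (f x - z).
      by rewrite !scalerBr addrACA -scalerDl (addrC t) subrK scale1r opprD.
    rewrite (le_lt_trans (ler_normD _ _))// !normrZ (ger0_norm t0).
    by rewrite ger0_norm ?subr_ge0//; exact: convex_combination_lt.
  - exact: lower_hemicontinuous_ball.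
  exists g => _; split; first split => // x.
    by have [v [[Fv _] gv]] := Fg x; exists v.
  move=> x; have [v [[_]]] := Fg x; rewrite -!ball_normE /= => fv gv.
  rewrite (_ : f x - g x = (f x - v) - (g x - v)); last by rewrite opprB addrA subrK.
  rewrite (le_trans (ler_normB _ _))//; move: fv gv; rewrite exprS invfM.
  by have := pow0 n; set a := _ ^- n; lra.
have [next nextP] := choice step.
have [f0 f0_cont Ff0] := approximate_selection (pow0 0%N) F0 F_convex F_lsc.
pose u := fix u n := if n is m.+1 then next (m, u m) else f0.
have u_approx n : approx n (u n) by elim: n => // n /(nextP (_, _)) [].
have u_step n x : `|u n x - u n.+1 x| <= 2 / 2 ^+ n.
  by have [_ +] := nextP (n, u n) (u_approx n); exact.
have [f fu] := choice (fun x => geometric_cvg (u_step^~ x)).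
exists f => x.
  apply/cvgrPdist_lt => e e0.
  (* Each of the two distances from [f] to [u n] is at most [4 * 2 ^- n], below [4 * e / 10]; with
     [e / 10] for [u n] itself the total is below [e]. *)
  have [|n ne] := @exists_expV2_lt R (e / 10); first by rewrite divr_gt0.
  have [/(_ x) /cvgrPdist_lt u_cont _] := u_approx n.
  near=> y.
  have uxy : `|u n x - u n y| < e / 10 by near: y; apply: u_cont; rewrite divr_gt0.
  rewrite (_ : f x - f y = (f x - u n x) + (u n x - u n y) - (f y - u n y)); last first.
    by rewrite addrA subrK opprB addrA subrK.
  rewrite (le_lt_trans (ler_normB _ _))//.
  have := ler_normD (f x - u n x) (u n x - u n y).
  by move: (fu x n) (fu y n) uxy ne; lra.
apply: F_closed => B /nbhs_ballP[e /= e0 eB].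
have [|n ne] := @exists_expV2_lt R (e / 10); first by rewrite divr_gt0.
have [_ /(_ x)[v [Fv]]] := u_approx n; rewrite -ball_normE /= => uv.
exists v; split=> //; apply: eB; rewrite -ball_normE /=.
rewrite -[f x](subrK (u n x)) -addrA (le_lt_trans (ler_normD _ _))//.
by move: (fu x n) uv ne; lra.
Unshelve. all: by end_near. Qed.

End Michael.

(** * Asymptotic centers *)

(** If [s n < N], then [n = t (s n)] is one of the finitely many values of [t] below [N]. *)
Lemma can_cvg_infty (s t : nat -> nat) : cancel s t -> s @ \oo --> \oo.
Proof.
move=> st B [N _ NB]; exists (\max_(k < N) t k).+1 => // n /= tn; apply: NB => /=.
rewrite leqNgt; apply/negP => sN; move: tn; rewrite ltnNge -[n]st.
by rewrite (leq_bigmax (Ordinal sN)).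
Qed.

(** * The function [limsup_dist x] and the asymptotic radius *)

Section limsup_dist.
Context {R : realType} {X : normedModType R}.
Implicit Types (x : linf X) (y z : X) (c e k : R).

Lemma bounded_linf_dist x y : bounded_fun (fun n => `|x n - y| : R^o).
Proof.
have [M xM] := linf_predP _ (linf_seqP x).
have PF : ProperFilter (globally [set: nat]).
  exact: (@globally_properfilter nat setT 0%N).
apply/ex_bound; exists (M + `|y|) => n _ /=.
by rewrite normr_id (le_trans (ler_normB _ _))// lerD2r.
Qed.

(** Trades the infimum of tail suprema for eventual inequalities, the form in which the later
    estimates are made. *)
Lemma limsup_dist_leP x y c : limsup_dist x y <= c <->
  forall e, 0 < e -> \forall n \near \oo, `|x n - y| <= c + e.
Proof.
have xy_bounded := bounded_linf_dist x y.
have tail_ub := has_ubound_sdrop (bounded_fun_has_ubound xy_bounded).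
rewrite /limsup_dist limn_supE//; split=> [xyc e e0|xyc].
  have : inf (range (sups (fun n => `|x n - y| : R^o))) < c + e.
    by rewrite (le_lt_trans xyc)// ltrDl.
  move=> /inf_lt[|_ [n _ <-] nce]; first by exists (sups (fun n => `|x n - y| : R^o) 0%N), 0%N.
  exists n => //= m /= nm; apply: le_trans (ltW nce).
  by apply: ub_le_sup; [exact: tail_ub|exists m].
apply/ler_addgt0Pr => e /xyc[n _ nce].
apply: (@le_trans _ _ (sups (fun n => `|x n - y| : R^o) n)).
  by apply: ge_inf; [exact: bounded_fun_has_lbound_sups|exists n].
apply: ge_sup; first by exists `|x n - y|, n => /=.
by move=> _ [m /= nm <-]; exact: nce.
Qed.

Lemma limsup_distP x y e : 0 < e ->
  \forall n \near \oo, `|x n - y| <= limsup_dist x y + e.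
Proof. by move=> e0; have /limsup_dist_leP := lexx (limsup_dist x y); exact. Qed.

Lemma limsup_dist_ge0 x y : 0 <= limsup_dist x y.
Proof.
apply/ler_addgt0Pr => e /(limsup_distP x y)[n _ /(_ n (leqnn n)) /= xy].
exact: le_trans (normr_ge0 _) xy.
Qed.

(** Eventual bounds pass to the reindexed sequence along [s] and back along [t]. An eventual right
    inverse covers both permutations and the forward shift. *)
Lemma limsup_dist_reindex x (s t : nat -> nat) :
  s @ \oo --> \oo -> t @ \oo --> \oo -> (\forall n \near \oo, s (t n) = n) ->
  limsup_dist (linf_reindex x s) = limsup_dist x.
Proof.
move=> s_oo t_oo st; apply/funext => y; apply/eqP; rewrite eq_le.
apply/andP; split; apply/limsup_dist_leP => e e0.
  by have := s_oo _ (limsup_distP x y e0).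
have := t_oo _ (limsup_distP (linf_reindex x s) y e0).
by apply: filterS2 st => n /= stn; rewrite stn.
Qed.

Lemma limsup_dist_triangle x y z :
  limsup_dist x y <= limsup_dist x z + `|z - y|.
Proof.
apply/limsup_dist_leP => e e0; near=> n.
have xz : `|x n - z| <= limsup_dist x z + e by near: n; exact: limsup_distP.
by have := ler_normD (x n - z) (z - y); rewrite addrA subrK; lra.
Unshelve. all: by end_near. Qed.

Lemma limsup_dist_linf_norm x x' y :
  limsup_dist x y <= limsup_dist x' y + `|x - x'|.
Proof.
apply/limsup_dist_leP => e e0; near=> n.
have x'y : `|x' n - y| <= limsup_dist x' y + e by near: n; exact: limsup_distP.
have := ler_normD (x n - x' n) (x' n - y); rewrite addrA subrK.
have xx'n : `|x n - x' n| <= `|x - x'| := le_linf_norm (x - x') n.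
lra.
Unshelve. all: by end_near. Qed.

Lemma limsup_dist_convex x y z t : 0 <= t -> t <= 1 ->
  limsup_dist x (t *: y + (1 - t) *: z) <=
    t * limsup_dist x y + (1 - t) * limsup_dist x z.
Proof.
move=> t0 t1; apply/limsup_dist_leP => e e0; near=> n.
have xy : `|x n - y| <= limsup_dist x y + e by near: n; exact: limsup_distP.
have xz : `|x n - z| <= limsup_dist x z + e by near: n; exact: limsup_distP.
have -> : x n - (t *: y + (1 - t) *: z) = t *: (x n - y) + (1 - t) *: (x n - z).
  by rewrite !scalerBr addrACA -scalerDl (addrC t) subrK scale1r opprD.
rewrite (le_trans (ler_normD _ _))// !normrZ (ger0_norm t0) ger0_norm ?subr_ge0//.
have := ler_wpM2l t0 xy; have := @ler_wpM2l _ (1 - t) _ _ _ xz; rewrite subr_ge0.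
by move=> /(_ t1); lra.
Unshelve. all: by end_near. Qed.

Lemma limsup_distZ k x y : 0 < k ->
  limsup_dist (k *: x) (k *: y) = k * limsup_dist x y.
Proof.
have le (r : R) x' y' : 0 < r ->
    limsup_dist (r *: x') (r *: y') <= r * limsup_dist x' y'.
  move=> r0; apply/limsup_dist_leP => e e0; near=> n.
  have xy : `|x' n - y'| <= limsup_dist x' y' + e / r.
    by near: n; apply: limsup_distP; rewrite divr_gt0.
  rewrite [_ n](_ : _ = r *: x' n)// -scalerBr normrZ gtr0_norm//.
  by move: xy; rewrite -(ler_pM2l r0) mulrDr (mulrC r (e / r)) divfK// gt_eqF.
move=> k0; apply/eqP; rewrite eq_le le//= -ler_pdivlMl//.
have := le k^-1 (k *: x) (k *: y); rewrite !scalerK ?gt_eqF// invr_gt0; exact.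
Unshelve. all: by end_near. Qed.

Lemma has_lbound_limsup_dist x : has_lbound (range (limsup_dist x)).
Proof. by exists 0 => _ [y _ <-]; exact: limsup_dist_ge0. Qed.

Lemma ar_le x y : ar x <= limsup_dist x y.
Proof. by apply: ge_inf; [exact: has_lbound_limsup_dist|exists y]. Qed.

Lemma le_ar x c : (forall y, c <= limsup_dist x y) -> c <= ar x.
Proof.
move=> xc; apply: lb_le_inf; first by exists (limsup_dist x 0), 0.
by move=> _ [y _ <-].
Qed.

Lemma arZ k x : 0 < k -> ar (k *: x) = k * ar x.
Proof.
have le (r : R) x' : 0 < r -> ar (r *: x') <= r * ar x'.
  move=> r0; rewrite -ler_pdivrMl//; apply: le_ar => y.
  by rewrite ler_pdivrMl// -limsup_distZ// ar_le.
move=> k0; apply/eqP; rewrite eq_le le//= -ler_pdivlMl//.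
by have := le k^-1 (k *: x); rewrite scalerK ?gt_eqF// invr_gt0; exact.
Qed.

End limsup_dist.

(** * Asymptotic centers as a set-valued map *)

Section asymptotic_center.
Context {R : realType} {X : normedModType R}.
Implicit Types (x : linf X) (y z : X).

Lemma acP x y : limsup_dist x y <= ar x -> ac x y.
Proof. by move=> xy; apply/eqP; rewrite eq_le xy ar_le. Qed.

Lemma closed_ac x : closed (ac x).
Proof.
move=> y ac_y; apply: acP; apply/ler_addgt0Pr => e e0.
have [|z [acz]] := ac_y (ball y e); first exact: nbhsx_ballx.
rewrite -ball_normE /= => yz; rewrite -acz distrC in yz *.
by have := limsup_dist_triangle x y z; lra.
Qed.

Lemma convex_ac x : convex_set (ac x : set (convex_lmodType X)).
Proof.
apply/convex_setP => y z t acy acz t0 t1; apply: acP.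
rewrite (le_trans (limsup_dist_convex _ _ _ t0 t1))// acy acz.
by rewrite -mulrDl addrC subrK mul1r.
Qed.

(* Rescaling turns the single constant in the definition of delta-cac into a
   linear modulus. *)
Lemma cac_linear delta x y s : 0 < delta -> cac X delta -> 0 <= s ->
  limsup_dist x y <= ar x + s -> exists2 v, ac x v & `|y - v| <= s / delta.
Proof.
move=> d0 cacX; rewrite le_eqVlt => /orP[/eqP <- xy|s0 xy].
  by exists y; [apply: acP; rewrite addr0 in xy|rewrite subrr normr0 mul0r].
(* Scaling by [k] turns the slack [s] into [delta]; scaling back turns the unit ball into the ball
   of radius [s / delta]. *)
pose k := delta / s; have k0 : 0 < k by rewrite divr_gt0.
have kN0 : k != 0 by rewrite gt_eqF.
have [|b b1 [v acv bv]] := cacX (k *: x) (k *: y).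
  rewrite /ac_/= limsup_distZ// arZ// -[delta in leRHS](divfK (lt0r_neq0 s0)).
  by rewrite -mulrDr ler_pM2l.
have vE : v = k *: (k^-1 *: v) by rewrite scalerKV.
exists (k^-1 *: v).
  by move: acv; rewrite /ac/= {1}vE limsup_distZ// arZ// => /(mulfI kN0).
have -> : y - k^-1 *: v = k^-1 *: b by rewrite -[y](scalerK kN0) -bv -scalerBr addrK.
rewrite normrZ normfV gtr0_norm// invf_div ler_piMr//.
by rewrite divr_ge0// ltW.
Qed.

Lemma ac_nonempty delta x : 0 < delta -> cac X delta -> ac x !=set0.
Proof.
move=> d0 cacX; have : ar x < ar x + 1 by rewrite ltrDl.
move=> /inf_lt[|_ [y _ <-] xy]; first by exists (limsup_dist x 0), 0.
by have [v acv _] := cac_linear d0 cacX ler01 (ltW xy); exists v.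
Qed.

(** Bounded sequences with the uniform distance between their functions [limsup_dist]. Sequences
    with the same function are at distance 0, so a continuous map into [X] cannot separate them. *)
Definition linf_limsup : Type :=
  initial_topology (limsup_dist : linf X -> arrow_uniform_type X R^o).

HB.instance Definition _ := PseudoMetric.on linf_limsup.

Lemma limsup_ballE (x x' : linf_limsup) e :
  ball x e x' <-> forall y, `|limsup_dist x y - limsup_dist x' y| < e.
Proof. by []. Qed.

(** If [x'] is within [r] of [x], a center [v] of [x] is optimal for [x'] up to [2 * r], so a center
    of [x'] lies within [2 * r / delta] of [v]. The choice of [r] makes this [e / 2]. *)
Lemma lower_hemicontinuous_ac delta : 0 < delta -> cac X delta ->
  lower_hemicontinuous (ac : linf_limsup -> set X).
Proof.
move=> d0 cacX O O_open; rewrite openE => x [v [acv Ov]].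
have /nbhs_ballP[e /= e0 eO] : nbhs v O by exact: open_nbhs_nbhs.
pose r := delta * e / 4; have r0 : 0 < r by rewrite divr_gt0// mulr_gt0.
apply/nbhs_ballP; exists r => //= x' /limsup_ballE xx'.
have arxx' : ar x - r <= ar x'.
  apply: le_ar => y; have := ar_le x y; move: (xx' y).
  by rewrite ltr_norml => /andP[]; lra.
have x'v : limsup_dist x' v <= ar x' + 2 * r.
  by move: (xx' v); rewrite acv ltr_norml => /andP[]; lra.
have [|w acw vw] := cac_linear d0 cacX _ x'v; first by rewrite mulr_ge0// ltW.
exists w; split => //; apply: eO; rewrite -ball_normE /=.
apply: le_lt_trans vw _; rewrite /r.
have -> : 2 * (delta * e / 4) / delta = e / 2 by field; rewrite gt_eqF.
by lra.
Qed.

Lemma continuous_linf_limsup : continuous (id : linf X -> linf_limsup).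
Proof.
move=> x B /nbhs_ballP[e /= e0 eB].
apply/nbhs_ballP; exists (e / 2); first by rewrite /= divr_gt0.
move=> x'; rewrite -ball_normE /= => xx'; apply/eB/limsup_ballE => y.
rewrite ltr_norml; have := limsup_dist_linf_norm x x' y.
by have := limsup_dist_linf_norm x' x y; rewrite distrC; lra.
Qed.

(** The limit attains the value 0, so the radius is 0 and every center is a limit of [x]. *)
Lemma ac_cvg x l : x @ \oo --> l -> ac x = [set l].
Proof.
move=> xl; have xl0 : limsup_dist x l <= 0.
  apply/limsup_dist_leP => e e0; rewrite add0r.
  by move/cvgrPdist_le: xl => /(_ _ e0); under eq_near do rewrite distrC.
have ar0 : ar x = 0.
  apply/eqP; rewrite eq_le (le_trans (ar_le _ l))//=.
  by apply: le_ar => y; exact: limsup_dist_ge0.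
apply/seteqP; split => [y|_ ->]; last by apply: acP; rewrite ar0.
rewrite /ac/= ar0 => xy; apply/esym/(cvg_unique _ xl) => //.
apply/cvgrPdist_le => e e0; have := limsup_distP x y e0; rewrite xy add0r.
by under eq_near do rewrite distrC.
Qed.

(** Every late term of [x] is within [e] of some late term of [x']. *)
Lemma limsup_dist_tail_close x x' e y : 0 <= e ->
  tail_close e x x' -> limsup_dist x y <= limsup_dist x' y + e.
Proof.
move=> e0 xx'; apply/limsup_dist_leP => d d0.
have [N _ x'y] := limsup_distP x' y d0.
have [M [xM _]] := xx' N; exists M => // n /= Mn.
have [|_ [k /= Nk <-] [_ [u /= u1 <-] xE]] := xM (x n); first by exists n.
have eu : `|e *: u| <= e by rewrite normrZ ger0_norm// ler_piMr.
have := ler_normD (x' k - y) (e *: u); rewrite addrAC xE.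
by have := x'y _ Nk; lra.
Qed.

Lemma tail_close_sym x x' e : tail_close e x x' -> tail_close e x' x.
Proof. by move=> xx' n; have [m []] := xx' n; exists m. Qed.

(** Ensures that [tail_dist] is the infimum of a nonempty set, so that its value 0 is never the
    default value of [inf] on the empty set. *)
Lemma tail_close_diam x x' : exists2 e, 0 < e & tail_close e x x'.
Proof.
have [M xM] := linf_predP _ (linf_seqP x).
have [M' x'M] := linf_predP _ (linf_seqP x').
have M0 := le_trans (normr_ge0 _) (xM 0%N).
have M'0 := le_trans (normr_ge0 _) (x'M 0%N).
have e0 : 0 < M + M' + 1 by lra.
have eN0 : M + M' + 1 != 0 by rewrite gt_eqF.
have sub n (z z' : linf X) : (forall i j, `|z i - z' j| <= M + M' + 1) ->
    sdrop z n `<=` Minkowski_sum (sdrop z' n)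
      [set (M + M' + 1) *: u | u in unit_ball].
  move=> zz' _ [i _ <-]; exists (z' n); first by exists n => /=.
  exists (z i - z' n); last by rewrite addrC subrK.
  exists ((M + M' + 1)^-1 *: (z i - z' n)); last by rewrite scalerKV.
  by rewrite /unit_ball/= normrZ normfV gtr0_norm// ler_pdivrMl// mulr1.
exists (M + M' + 1) => // n; exists n; split; apply: sub => i j;
  rewrite (le_trans (ler_normB _ _))//.
  by have := xM i; have := x'M j; lra.
by have := xM j; have := x'M i; lra.
Qed.

Lemma tail_dist0_limsup_dist x x' :
  tail_dist x x' = 0 -> limsup_dist x = limsup_dist x'.
Proof.
have le (z z' : linf X) y : tail_dist z z' = 0 ->
    limsup_dist z y <= limsup_dist z' y.
  move=> zz'; apply/ler_addgt0Pr => e e0.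
  have : tail_dist z z' < e by rewrite zz'.
  move=> /inf_lt[|d [d0 zd] de].
    by have [d] := tail_close_diam z z'; exists d.
  apply: le_trans (limsup_dist_tail_close y (ltW d0) zd) _.
  by rewrite lerD2l ltW.
have tail_distC (z z' : linf X) : tail_dist z z' = tail_dist z' z :> R.
  by rewrite /tail_dist; congr inf; apply/seteqP; split=> e [e0 /tail_close_sym].
move=> xx'; apply/funext => y; apply/eqP; rewrite eq_le !le//.
by rewrite tail_distC.
Qed.

End asymptotic_center.

Theorem corollary3p6 (R : realType) (X : completeNormedModType R) (delta : R)
    (delta_gt0 : 0 < delta) (cacX : cac X delta) :
  exists phi : linf X -> X,
    [/\ continuous phi,
        forall x, ac x (phi x) &
        forall x y, tail_dist x y = 0 -> phi x = phi y] /\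
    [/\ forall x : linf X, cvgn x -> phi x = limn x,
        forall x, phi x = phi (forward x) &
        forall (x : linf X) (s : nat -> nat),
          bijective s -> phi x = phi (linf_reindex x s)].
Proof.
have [phi phi_cont phi_ac] := @Michael_selection R (linf_limsup (X := X)) X ac
  (fun x => ac_nonempty x delta_gt0 cacX) (@convex_ac _ _) (@closed_ac _ _)
  (lower_hemicontinuous_ac delta_gt0 cacX).
(* Such [x] and [y] lie in every ball around each other, so continuity of [phi] for the pseudometric
   makes their images arbitrarily close. *)
have phi_eq (x y : linf X) : limsup_dist x = limsup_dist y -> phi x = phi y.
  move=> xy; apply/eqP; rewrite -subr_eq0 -normr_le0; apply/ler_addgt0Pr => e e0.
  move/cvgrPdist_lt: (phi_cont x) => /(_ _ e0) /nbhs_ballP[d /= d0 xd].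
  by rewrite add0r ltW// xd//; apply/limsup_ballE => z; rewrite xy subrr normr0.
exists phi; split; split => //.
- by move=> x B /phi_cont; exact: continuous_linf_limsup.
- by move=> x y /tail_dist0_limsup_dist /phi_eq.
- by move=> x /ac_cvg xE; have := phi_ac x; rewrite xE.
(* [predn] is a right inverse of the shift only from index 1 on, since [predn 0] is 0. *)
- move=> x; apply: phi_eq; rewrite (@limsup_dist_reindex _ _ _ _ predn)//.
  + by move=> B [n _ nB]; exists n => // m /= nm; apply: nB => /=; exact: leqW.
  + by move=> B [n _ nB]; exists n.+1 => // -[|m]//=; rewrite ltnS => /nB.
  + by exists 1%N => // -[].
- move=> x s [t st ts]; apply: phi_eq; rewrite (@limsup_dist_reindex _ _ _ _ t)//.
  + exact: can_cvg_infty st.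
  + exact: can_cvg_infty ts.
  + by exists 0%N => // n _; exact: ts.
Qed.
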